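(* The uniform, directed 1-neighbour knapsack problem admits a polynomial-time approximation scheme: for every fixed $\varepsilon>0$ there is an algorithm running in time $n^{O(1/\varepsilon)}$ that returns a feasible solution of size at least $(1-\varepsilon)$ times the optimum.
   Context: Uniform, directed 1-neighbour knapsack problem: input is a directed graph $G=(V,E)$ with $n$ vertices and a positive integer capacity $k$; a feasible solution is a set $U\subseteq V$ with $|U|\le k$ such that every $v\in U$ having at least one out-neighbour in $G$ has at least one out-neighbour in $U$; the objective is to maximize $|U|$. *)

(* Defs.v *)
From mathcomp Require Import all_boot.

Set Implicit Arguments.
Unset Strict Implicit.
Unset Printing Implicit Defensive.

(** * The uniform, directed 1-neighbour knapsack problem *)

(** A digraph on [V] is an arbitrary edge set [E] included in [V * V], given as
    a boolean relation; loops are not excluded. *)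
Definition feasible (V : finType) (E : rel V) (k : nat) (U : {set V}) : bool :=
  (#|U| <= k) &&
  [forall v in U, [exists w, E v w] ==> [exists w in U, E v w]].

(** [set0] is always feasible, so this is a maximum over a nonempty family. *)
Definition opt (V : finType) (E : rel V) (k : nat) : nat :=
  \max_(U : {set V} | feasible E k U) #|U|.

(** * Algorithms: structured unit-cost RAM programs

    Memory consists of scalar variables and one-dimensional arrays, holding
    natural numbers. A program is a finite term, so it mentions finitely many
    of them, and these can be interleaved in the memory of an ordinary RAM with
    constant-factor overhead. Addition and truncated subtraction are the only
    arithmetic operations: unit-cost multiplication is excluded because, on
    unbounded integers, it is too powerful to measure polynomial time. *)

Inductive expr : Type :=
| Const of nat
| Var of nat
| Cell of nat & expr          (* [Cell a e] is entry [e] of array [a] *)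
| Add of expr & expr
| Sub of expr & expr.

(** A test is an expression; it succeeds when its value is nonzero. *)
Inductive cmd : Type :=
| Skip
| Assign of nat & expr
| Store of nat & expr & expr  (* [Store a e1 e2] is [a[e1] := e2] *)
| Seq of cmd & cmd
| If of expr & cmd & cmd
| While of expr & cmd.

Record state : Type := State { var : nat -> nat; arr : nat -> nat -> nat }.

Definition set_var (s : state) (x v : nat) : state :=
  State (fun y => if y == x then v else var s y) (arr s).

Definition set_arr (s : state) (a i v : nat) : state :=
  State (var s)
    (fun b j => if (b == a) && (j == i) then v else arr s b j).

Fixpoint eval (s : state) (e : expr) : nat :=
  match e with
  | Const c => c
  | Var x => var s x
  | Cell a e1 => arr s a (eval s e1)
  | Add e1 e2 => eval s e1 + eval s e2
  | Sub e1 e2 => eval s e1 - eval s e2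
  end.

Fixpoint ecost (e : expr) : nat :=
  match e with
  | Const _ | Var _ => 1
  | Cell _ e1 => (ecost e1).+1
  | Add e1 e2 | Sub e1 e2 => (ecost e1 + ecost e2).+1
  end.

(** [exec c s s' t]: started in [s], the program [c] halts in [s'] after
    exactly [t] steps. *)
Inductive exec : cmd -> state -> state -> nat -> Prop :=
| exec_skip s :
    exec Skip s s 1
| exec_assign s x e :
    exec (Assign x e) s (set_var s x (eval s e)) (ecost e).+1
| exec_store s a e1 e2 :
    exec (Store a e1 e2) s (set_arr s a (eval s e1) (eval s e2))
         (ecost e1 + ecost e2).+1
| exec_seq s s' s'' c1 c2 t1 t2 :
    exec c1 s s' t1 -> exec c2 s' s'' t2 ->
    exec (Seq c1 c2) s s'' (t1 + t2)
| exec_if_true s s' e c1 c2 t :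
    eval s e != 0 -> exec c1 s s' t ->
    exec (If e c1 c2) s s' (ecost e + t).+1
| exec_if_false s s' e c1 c2 t :
    eval s e = 0 -> exec c2 s s' t ->
    exec (If e c1 c2) s s' (ecost e + t).+1
| exec_while_false s e c :
    eval s e = 0 ->
    exec (While e c) s s (ecost e).+1
| exec_while_true s s' s'' e c t1 t2 :
    eval s e != 0 -> exec c s s' t1 -> exec (While e c) s' s'' t2 ->
    exec (While e c) s s'' (ecost e + t1 + t2).+1.

(** An instance with vertices [0, ..., n-1] is presented with [n] in variable
    [0], [k] in variable [1] and the row-major adjacency matrix in array [0];
    all other memory is zero. *)
Definition input (n : nat) (E : rel 'I_n) (k : nat) : state :=
  State
    (fun x => if x == 0 then n else if x == 1 then k else 0)
    (fun a p =>
       if a == 0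
       then nat_of_bool
              [exists i : 'I_n, exists j : 'I_n, (p == i * n + j) && E i j]
       else 0).

(** The returned vertex set is read from array [1], as a characteristic
    vector. *)
Definition output (n : nat) (s : state) : {set 'I_n} :=
  [set i : 'I_n | arr s 1 i != 0].

(* Main.v *)
Require Import Defs.
From HB Require Import structures.
From mathcomp Require Import all_boot all_order all_algebra.
From mathcomp Require Import all_classical all_reals all_analysis.
From mathcomp Require Import fintype finset zify lra.

Set Implicit Arguments.
Unset Strict Implicit.
Unset Printing Implicit Defensive.

(** Give every sink a loop, so that [U] is feasible iff [#|U| <= k] and every
    vertex of [U] has a successor in [U]. Following successors inside an optimal
    [U] ends in disjoint cycles (the cores) of total length at most [#|U|], and
    every vertex of [U] reaches one of them. Fewer than [m + 1] cores are longer
    than [k / m], so one vertex of each of these can be guessed by trying all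
    [m]-tuples. A candidate starts from shortest cycles through the guessed
    vertices, then tries to add a shortest cycle through every vertex in turn,
    and finally adds predecessors as long as the capacity allows. If a core of
    length at most [k / m] was rejected, the candidate has size greater than
    [k - k / m]; otherwise all cores are present and the predecessor closure
    reaches size [min k #|U|] at least. *)

(** * Cost-bounded weakest preconditions *)

(* If every loop runs at most [n] times, [c] costs at most
   [maxn n 2 ^ cost_exp c]. *)
Fixpoint cost_exp (c : cmd) : nat :=
  match c with
  | Skip => 0
  | Assign _ e => (ecost e).+1
  | Store _ e1 e2 => (ecost e1 + ecost e2).+1
  | Seq c1 c2 => (cost_exp c1 + cost_exp c2).+1
  | If e c1 c2 => (ecost e + cost_exp c1 + cost_exp c2).+2
  | While e c1 => (ecost e + cost_exp c1).+4
  end.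

Fixpoint writes_var (c : cmd) (x : nat) : bool :=
  match c with
  | Assign y _ => x == y
  | Seq c1 c2 | If _ c1 c2 => writes_var c1 x || writes_var c2 x
  | While _ c1 => writes_var c1 x
  | Skip | Store _ _ _ => false
  end.

Fixpoint writes_arr (c : cmd) (a : nat) : bool :=
  match c with
  | Store b _ _ => a == b
  | Seq c1 c2 | If _ c1 c2 => writes_arr c1 a || writes_arr c2 a
  | While _ c1 => writes_arr c1 a
  | Skip | Assign _ _ => false
  end.

Definition agree (c : cmd) (s s' : state) : Prop :=
  (forall x, ~~ writes_var c x -> var s' x = var s x) /\
  (forall a, ~~ writes_arr c a -> arr s' a = arr s a).

Lemma agree_refl c s : agree c s s.
Proof. by []. Qed.

Lemma agree_trans c s1 s2 s3 : agree c s1 s2 -> agree c s2 s3 -> agree c s1 s3.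
Proof.
move=> [v1 a1] [v2 a2]; split=> x nx; first by rewrite v2 // v1.
by rewrite a2 // a1.
Qed.

Lemma agree_sub c c' s s' :
    (forall x, writes_var c x -> writes_var c' x) ->
    (forall a, writes_arr c a -> writes_arr c' a) ->
  agree c s s' -> agree c' s s'.
Proof.
move=> sv sa [v a]; split=> x nx; first by apply: v; apply: contra nx => /sv.
by apply: a; apply: contra nx => /sa.
Qed.

Lemma agree_set_var c s x v : writes_var c x -> agree c s (set_var s x v).
Proof.
move=> cx; split=> [y ny|//]; rewrite /=; case: eqP => // yx.
by rewrite yx cx in ny.
Qed.

(** The frame rule. It is read off the program text, so invariants below mention only the memory
    that a command may write. *)
Lemma exec_agree c s s' t : exec c s s' t -> agree c s s'.
Proof.
elim=> {c s s' t} //.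
- by move=> s x e; apply: agree_set_var; rewrite /= eqxx.
- move=> s a e1 e2; split=> [//|b /= nb].
  by apply/funext => j; rewrite (negbTE nb).
- move=> s s' s'' c1 c2 t1 t2 _ ih1 _ ih2; apply: agree_trans.
    by apply: agree_sub ih1 => x /= ->.
  by apply: agree_sub ih2 => x /= ->; rewrite orbT.
- by move=> s s' e c1 c2 t _ _; apply: agree_sub => x /= ->.
- by move=> s s' e c1 c2 t _ _; apply: agree_sub => x /= ->; rewrite orbT.
- by move=> s s' s'' e c t1 t2 _ _ ih1 _ ih2; apply: agree_trans ih1 ih2.
Qed.

Section Wp.
Variable n : nat.

Let N := maxn n 2.

Let leN a b : a <= b -> N ^ a <= N ^ b.
Proof. by move=> ab; rewrite leq_exp2l //; lia. Qed.

Let lt_expN a : a < N ^ a.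
Proof. by apply: ltn_expl; lia. Qed.

(** Both terms are at most [N ^ (a + b)], and since [N >= 2] doubling costs one more factor [N].
    This is why the base is [maxn n 2]. *)
Let addN a b x y : x <= N ^ a -> y <= N ^ b -> x + y <= N ^ (a + b).+1.
Proof.
move=> xa yb; rewrite expnS.
have := leN (leq_addr b a); have := leN (leq_addl a b).
have: 2 * N ^ (a + b) <= N * N ^ (a + b) by rewrite leq_mul2r; lia.
lia.
Qed.

Definition wp (c : cmd) (Q : state -> Prop) (s : state) : Prop :=
  exists s' t, [/\ exec c s s' t, t <= N ^ cost_exp c & Q s'].

Lemma wp_agree c Q s :
  wp c (fun s' => agree c s s' -> Q s') s -> wp c Q s.
Proof.
move=> [s' [t [ex le q]]]; exists s', t; split=> //.
exact/q/(exec_agree ex).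
Qed.

Lemma wp_mono c (Q Q' : state -> Prop) s :
  (forall s', agree c s s' -> Q s' -> Q' s') -> wp c Q s -> wp c Q' s.
Proof.
move=> QQ' [s' [t [ex le q]]]; exists s', t; split=> //.
exact: QQ' (exec_agree ex) q.
Qed.

Lemma wp_skip (Q : state -> Prop) s : Q s -> wp Skip Q s.
Proof. by move=> q; exists s, 1; split=> //; exact: exec_skip. Qed.

Lemma wp_assign x e (Q : state -> Prop) s :
  Q (set_var s x (Defs.eval s e)) -> wp (Assign x e) Q s.
Proof.
move=> q; eexists _, _; split; [exact: exec_assign| |exact: q].
exact: ltnW (lt_expN _).
Qed.

Lemma wp_store a e1 e2 (Q : state -> Prop) s :
  Q (set_arr s a (Defs.eval s e1) (Defs.eval s e2)) -> wp (Store a e1 e2) Q s.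
Proof.
move=> q; eexists _, _; split; [exact: exec_store| |exact: q].
exact: ltnW (lt_expN _).
Qed.

Lemma wp_seq c1 c2 (Q : state -> Prop) s :
  wp c1 (wp c2 Q) s -> wp (Seq c1 c2) Q s.
Proof.
move=> [s1 [t1 [ex1 le1 [s2 [t2 [ex2 le2 q]]]]]].
exists s2, (t1 + t2); split=> //; first exact: exec_seq ex1 ex2.
exact: addN.
Qed.

Lemma wp_if e c1 c2 (Q : state -> Prop) s :
    (Defs.eval s e != 0 -> wp c1 Q s) -> (Defs.eval s e = 0 -> wp c2 Q s) ->
  wp (If e c1 c2) Q s.
Proof.
move=> ht hf; have [e0|e0] := eqVneq (Defs.eval s e) 0;
  [case: (hf e0)|case: (ht e0)] => s' [t [ex le q]]; exists s', (ecost e + t).+1; split=> //.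
- exact: exec_if_false.
- have := addN (ltnW (lt_expN (ecost e).+1)) le; rewrite /= addSn.
  by move/leq_trans; apply; apply: leN; lia.
- exact: exec_if_true.
- have := addN (ltnW (lt_expN (ecost e).+1)) le; rewrite /= addSn.
  by move/leq_trans; apply; apply: leN; lia.
Qed.

(** The index of [I] counts iterations. Demanding [i < n] whenever the test succeeds yields
    termination and the cost bound at once. *)
Lemma wp_while e c (I : nat -> state -> Prop) (Q : state -> Prop) s :
    I 0 s ->
    (forall i s1, agree (While e c) s s1 -> I i s1 -> Defs.eval s1 e != 0 ->
       i < n /\ wp c (I i.+1) s1) ->
    (forall i s1, agree (While e c) s s1 -> I i s1 -> Defs.eval s1 e = 0 -> Q s1) ->
  wp (While e c) Q s.
Proof.
move=> I0 step fin.
have loop m i s1 : n - i <= m -> agree (While e c) s s1 -> I i s1 ->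
  exists s' t, [/\ exec (While e c) s1 s' t,
    t <= m * (ecost e + N ^ cost_exp c).+1 + (ecost e).+1 & Q s'].
  elim: m i s1 => [|m ih] i s1 ni ag Ii; have [e0|e0] := eqVneq (Defs.eval s1 e) 0.
  - exists s1, (ecost e).+1; split; [exact: exec_while_false|lia|exact: fin _ _ ag Ii e0].
  - by have [lt_in _] := step _ _ ag Ii e0; lia.
  - exists s1, (ecost e).+1; split; [exact: exec_while_false|lia|exact: fin _ _ ag Ii e0].
  have [lt_in [s2 [t2 [ex2 le2 I2]]]] := step _ _ ag Ii e0.
  have ag2 : agree (While e c) s s2 by apply: agree_trans ag (exec_agree ex2).
  have [|s3 [t3 [ex3 le3 q3]]] := ih i.+1 s2 _ ag2 I2; first lia.
  exists s3, (ecost e + t2 + t3).+1; split=> //.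
    exact: exec_while_true ex2 ex3.
  by rewrite mulSn; lia.
have [s' [t [ex le q]]] := loop n 0 s (leq_subr _ _) (agree_refl _ _) I0.
(* Test and body together cost at most [N ^ ((ecost e).+1 + cost_exp c).+1]. The factor [n] adds one
   to the exponent, and the doubling that absorbs the last test adds another, which gives [.+4]. *)
exists s', t; split=> //; apply: leq_trans le _.
have leq1 := addN (ltnW (lt_expN (ecost e).+1)) (leqnn (N ^ cost_exp c)).
have leq2 : n * (ecost e + N ^ cost_exp c).+1 <=
    N ^ ((ecost e).+1 + cost_exp c).+2.
  rewrite expnS; apply: leq_mul; first exact: leq_maxl.
  by move: leq1; rewrite addSn.
have leq3 : (ecost e).+1 <= N ^ ((ecost e).+1 + cost_exp c).+2.
  by apply: leq_trans (ltnW (lt_expN _)) (leN _); lia.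
have := leq_add leq2 leq3; rewrite addnn -mul2n => /leq_trans; apply.
rewrite [cost_exp _]/= [N ^ (_).+4]expnS addSn leq_mul2r leq_maxr orbT //.
Qed.

Definition for_ (x : nat) (c : cmd) : cmd :=
  Seq (Assign x (Const 0))
      (While (Defs.Sub (Var 0) (Var x)) (Seq c (Assign x (Add (Var x) (Const 1))))).

Lemma wp_for x c (I : nat -> state -> Prop) (Q : state -> Prop) s :
    x != 0 -> ~~ writes_var c 0 -> ~~ writes_var c x -> var s 0 = n ->
    I 0 (set_var s x 0) ->
    (forall (i : 'I_n) s1, agree (for_ x c) s s1 -> var s1 x = i -> I i s1 ->
       wp c (fun s2 => I i.+1 (set_var s2 x i.+1)) s1) ->
    (forall s1, agree (for_ x c) s s1 -> I n s1 -> Q s1) ->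
  wp (for_ x c) Q s.
Proof.
move=> x0 c0 cx s0 I0 step fin; apply/wp_seq/wp_assign => /=.
set s' := set_var s x 0.
have ags : agree (for_ x c) s s' by apply: agree_set_var; rewrite /= eqxx.
have agw s1 : agree (While (Defs.Sub (Var 0) (Var x))
    (Seq c (Assign x (Add (Var x) (Const 1))))) s' s1 -> agree (for_ x c) s s1.
  move=> ag; apply: agree_trans ags _; apply: agree_sub ag => y //= ->.
  by rewrite orbT.
apply: (wp_while (I := fun i s1 =>
  [/\ i <= n, var s1 0 = n, var s1 x = i & I i s1])).
- by split=> //=; rewrite ?eqxx // eq_sym (negbTE x0).
- move=> i s1 ag [lein s10 s1x Ii] /=; rewrite s10 s1x => lt_in.
  have ltin : i < n by lia.
  split=> //; apply: wp_seq.
  apply: wp_mono (step (Ordinal ltin) s1 (agw _ ag) s1x Ii) => s2 [agv _] I2.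
  apply: wp_assign => /=; rewrite eqxx eq_sym (negbTE x0) !agv // s1x s10 addn1.
  by split.
- move=> i s1 ag [lein s10 s1x Ii] /=; rewrite s10 s1x => lt_in.
  apply: fin (agw _ ag) _; suff -> : n = i by [].
  by lia.
Qed.

End Wp.

(** * Iterating over the edges *)

(* Variables: 2, 3 the current edge (v, w); 4 the offset v * n; 5 the round; 6 the
   vertex u to be added; 7 the walker; 8 the size of the current set; 9 the size
   of the trial set; 10, 13 loop counters; 11 the size of the best set; 12 a
   flag; 20 + j the j-th guess. Arrays: 1 the best set; 2 the current set; 3 the
   distance to u; 4 the next vertex towards u; 5 the trial set. *)
Definition edges (c : cmd) : cmd :=
  Seq (Assign 4 (Const 0))
      (for_ 2 (Seq (for_ 3 (If (Cell 0 (Add (Var 4) (Var 3))) c Skip))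
                   (Assign 4 (Add (Var 4) (Var 0))))).

Section Edges.
Variables (n : nat) (e : rel 'I_n).

Definition adjacency (s : state) : Prop :=
  forall v w : 'I_n, (arr s 0 (v * n + w) != 0) = e v w.

Lemma wp_edges c (J : state -> Prop) (settled : 'I_n -> 'I_n -> state -> Prop)
    (Q : state -> Prop) s :
    (forall x, x \in [:: 0; 2; 3; 4] -> ~~ writes_var c x) ->
    ~~ writes_arr c 0 -> var s 0 = n -> adjacency s ->
    (forall x a s1, x \in [:: 2; 3; 4] -> J s1 -> J (set_var s1 x a)) ->
    (forall x a v w s1, x \in [:: 2; 3; 4] ->
       settled v w s1 -> settled v w (set_var s1 x a)) ->
    J s ->
    (forall v w s1, e v w -> agree (edges c) s s1 ->
       var s1 2 = v -> var s1 3 = w -> J s1 ->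
       wp n c (fun s2 => [/\ J s2, settled v w s2 &
                 forall v' w', settled v' w' s1 -> settled v' w' s2]) s1) ->
    (forall s1, agree (edges c) s s1 -> J s1 ->
       (forall v w, e v w -> settled v w s1) -> Q s1) ->
  wp n (edges c) Q s.
Proof.
move=> cv ca s0 adj Jset dset Js step fin; apply/wp_seq/wp_assign => /=.
have c0 : writes_var c 0 = false by apply/negbTE/cv.
have c2 : writes_var c 2 = false by apply/negbTE/cv.
have c3 : writes_var c 3 = false by apply/negbTE/cv.
have c4 : writes_var c 4 = false by apply/negbTE/cv.
have ag0 : agree (edges c) s (set_var s 4 0) by apply: agree_set_var.
apply: (wp_for (I := fun i s1 => [/\ J s1, var s1 4 = i * n &
    forall v w : 'I_n, v < i -> e v w -> settled v w s1])) => //=.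
- by rewrite c0.
- by rewrite c2.
- by split=> //; apply: (Jset) => //; apply: Jset.
- move=> i s1 ag1 s12 [J1 s14 D1].
  have {}ag1 : agree (edges c) s s1.
    by apply: agree_trans ag0 (agree_sub _ _ ag1) => x //= ->; rewrite orbT.
  have s10 : var s1 0 = n by case: ag1 => -> //=; rewrite c0.
  apply: wp_seq; apply: (wp_for (I := fun j s2 => J s2 /\
    forall v w : 'I_n, (v < i) || (v == i) && (w < j) -> e v w ->
      settled v w s2)) => //=.
  + by rewrite c0.
  + by rewrite c3.
  + split=> [|v w]; first exact: Jset.
    by rewrite ltn0 andbF orbF => vi evw; apply: dset => //; apply: D1.
  + move=> j s2 ag2 s23 [J2 D2].
    have s22 : var s2 2 = i by case: ag2 => -> //=; rewrite c2.
    have s24 : var s2 4 = i * n by case: ag2 => -> //=; rewrite c4.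
    have {}ag2 : agree (edges c) s s2.
      apply: agree_trans ag1 (agree_sub _ _ ag2) => x /=; lia.
    have adj2 : arr s2 0 = arr s 0.
      by case: ag2 => _ -> //=; rewrite !orbF.
    apply: wp_if => /=; rewrite s24 s23 adj2.
      rewrite adj => eij; apply: wp_mono (step i j s2 eij ag2 s22 s23 J2).
      move=> s3 _ [J3 dij mono]; split=> [|v w lt_v evw]; first exact: Jset.
      apply: dset => //.
      have [/andP[/eqP-> /eqP->] //|ne] := boolP ((v == i) && (w == j)).
      apply/mono/D2 => //; move: ne lt_v; rewrite -!val_eqE /=; lia.
    move=> /eqP; rewrite -[_ == 0]negbK adj => eij; apply: wp_skip.
    split=> [|v w lt_v evw]; first exact: Jset.
    apply: dset => //; apply: D2 => //.
    have [/andP[/eqP vi /eqP wj]|] := boolP ((v == i) && (w == j)).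
      by rewrite -vi -wj evw in eij.
    by move: lt_v; rewrite -!val_eqE /=; lia.
  + move=> s2 ag2 [J2 D2]; apply: wp_assign => /=; split.
    * by do 2!apply: (Jset) => //.
    * case: ag2 => agv _; rewrite !agv /= ?c0 ?c4 //.
      by rewrite s14 s10 mulSn addnC.
    * move=> v w lt_v evw; do 2!apply: (dset) => //; apply: D2 => //.
      by move: lt_v (ltn_ord w); rewrite -val_eqE /=; lia.
- move=> s1 ag1 [J1 _ D1]; apply: fin => [||v w].
  + by apply: agree_trans ag0 (agree_sub _ _ ag1) => x //= ->; rewrite orbT.
  + by [].
  + by apply: D1.
Qed.
End Edges.

(** * Distances to a vertex *)

Definition relax : cmd :=
  If (Defs.Sub (Cell 3 (Var 2)) (Add (Cell 3 (Var 3)) (Const 1)))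
     (Seq (Store 3 (Var 2) (Add (Cell 3 (Var 3)) (Const 1)))
          (Store 4 (Var 2) (Var 3)))
     Skip.

(* [n + 1] stands for an infinite distance. The distance of [u] (variable 6) to
   itself is the length of a shortest cycle through [u], hence the separate
   initialisation on edges into [u]. *)
Definition distances : cmd :=
  Seq (for_ 2 (Store 3 (Var 2) (Add (Var 0) (Const 1))))
 (Seq (edges (If (Add (Defs.Sub (Var 3) (Var 6)) (Defs.Sub (Var 6) (Var 3)))
                 Skip
                 (Seq (Store 3 (Var 2) (Const 1)) (Store 4 (Var 2) (Var 3)))))
      (for_ 5 (edges relax))).

Section Distances.
Variables (n : nat) (e : rel 'I_n).

Fixpoint walk (l : nat) (v w : 'I_n) : Prop :=
  if l is l'.+1 then exists2 x, e v x & walk l' x w else v = w.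

(** A label at most [n] counts as finite. Its pointer leads to [u] or to a smaller label, so
    following pointers from [v] reaches [u] within [D v] steps. Arrival at [u] is a separate
    alternative because [D u] stands for a cycle length, not zero. *)
Definition sound (u : 'I_n) (D N : nat -> nat) : Prop :=
  (forall v : 'I_n, 0 < D v) /\
  (forall v : 'I_n, D v <= n ->
     exists2 w : 'I_n, N v = w & e v w && ((w == u) || (D w < D v))).

(** Labels only go down, so lowering one cannot spoil the strict decrease required at the other
    vertices. *)
Lemma sound_upd u (D N : nat -> nat) (v w : 'I_n) a :
    sound u D N -> e v w -> 0 < a <= D v -> (w == u) || (D w < a) ->
  sound u (fun j => if j == v then a else D j)
          (fun j => if j == v then w : nat else N j).
Proof.
move=> [D0 Ds] evw /andP[a0 av] wa.
have leD (x : 'I_n) : (if x == v :> nat then a else D x) <= D x.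
  by case: eqP => // /val_inj ->.
split=> x; first by case: ifP.
case: eqP => [/val_inj ->|_] Dx.
  exists w => //; rewrite evw /=; case/orP: wa => [->//|wa].
  by rewrite (leq_ltn_trans (leD w) wa) orbT.
have [y Ny /andP[exy yD]] := Ds x Dx; exists y => //; rewrite exy /=.
case/orP: yD => [->//|yD]; by rewrite (leq_ltn_trans (leD y) yD) orbT.
Qed.

(** Updates are in place, so an edge may read a label already improved in the same round. As labels
    only decrease, the bound by the labels at the start of the round still holds. *)
Lemma wp_relax_edges u (Q : state -> Prop) s :
    var s 0 = n -> adjacency e s -> sound u (arr s 3) (arr s 4) ->
    (forall s', agree (edges relax) s s' -> sound u (arr s' 3) (arr s' 4) ->
       (forall v w, e v w -> arr s' 3 v <= (arr s 3 w).+1) ->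
       (forall v : 'I_n, arr s' 3 v <= arr s 3 v) -> Q s') ->
  wp n (edges relax) Q s.
Proof.
move=> s0 adj snd fin.
apply: (wp_edges (J := fun s1 => sound u (arr s1 3) (arr s1 4) /\
                 forall v : 'I_n, arr s1 3 v <= arr s 3 v)
        (settled := fun v w s1 => arr s1 3 v <= (arr s 3 w).+1) _ _ s0 adj) => //.
- move=> v w s1 evw _ s12 s13 [snd1 le1]; apply: wp_if => /=; rewrite s12 s13.
    move=> lt_wv; apply/wp_seq/wp_store/wp_store; rewrite /= s12 s13.
    split=> [||v' w'].
    + split=> [|x]; first by apply: sound_upd => //; lia.
      by case: eqP => // /val_inj ->; have := le1 v; lia.
    + by rewrite eqxx; have := le1 w; lia.
    + by case: eqP => // /val_inj ->; have := le1 v; lia.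
  move=> le_vw; apply: wp_skip; split=> //; have := le1 w; lia.
- by move=> s1 ag [snd1 le1] don; apply: fin.
Qed.

Lemma wp_distances (u : 'I_n) (Q : state -> Prop) s :
    var s 0 = n -> adjacency e s -> var s 6 = u ->
    (forall s', agree distances s s' -> sound u (arr s' 3) (arr s' 4) ->
       (forall l v, 0 < l <= n -> walk l v u -> arr s' 3 v <= l) -> Q s') ->
  wp n distances Q s.
Proof.
move=> s0 adj s6 fin; apply: wp_agree; apply: wp_seq.
apply: (wp_for (I := fun i s1 => forall v : 'I_n, v < i -> arr s1 3 v = n.+1)) => //.
  move=> i s1 ag s12 I1; apply: wp_store => v; rewrite /= s12 ltnS leq_eqVlt.
  by case: eqP => [_ _|_ /I1 //]; case: ag => -> //; rewrite s0 addn1.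
move=> s1 ag1 D1; apply: wp_seq.
have s10 : var s1 0 = n by case: ag1 => -> //.
have s16 : var s1 6 = u by case: ag1 => -> //.
have adj1 : adjacency e s1 by case: ag1 => _ a1 v w; rewrite a1.
apply: (wp_edges (J := fun s2 => sound u (arr s2 3) (arr s2 4))
   (settled := fun v w s2 => w = u -> arr s2 3 v <= 1) _ _ s10 adj1) => //.
- by split=> v; rewrite D1 ?ltn_ord // ltnn.
- move=> v w s2 evw ag2 s22 s23 snd2.
  have s26 : var s2 6 = u by case: ag2 => -> //.
  apply: wp_if => /=; rewrite s23 s26.
    by move=> neq; apply: wp_skip; split=> // wu; move: neq; rewrite wu; lia.
  move=> eq_uw; have {eq_uw}wu : w = u by apply: val_inj => /=; lia.
  apply/wp_seq/wp_store/wp_store; rewrite /= s22 s23; split=> [||v' w' d wu'].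
  + apply: sound_upd => //; last by rewrite wu eqxx.
    by case: snd2 => /(_ v).
  + by rewrite eqxx.
  + by case: eqP => // _; apply: d wu'.
move=> s2 ag2 snd2 d2.
have s20 : var s2 0 = n by case: ag2 => -> //.
have adj2 : adjacency e s2 by case: ag2 => _ a2 v w; rewrite a2.
(* Bellman-Ford: [i] rounds account for walks of up to [i.+1] edges, the first edge being covered by
   the initialisation. *)
apply: (wp_for (I := fun i s3 => sound u (arr s3 3) (arr s3 4) /\
  forall l v, 0 < l <= i.+1 -> walk l v u -> arr s3 3 v <= l)) => //.
- split=> // l v l1; have -> : l = 1 by move: l1 => /=; lia.
  by case=> x evx /= xu; apply: d2 evx xu.
- move=> i s3 ag3 s35 [snd3 d3].
  have s30 : var s3 0 = n by case: ag3 => -> //.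
  have adj3 : adjacency e s3 by case: ag3 => _ a3 v w; rewrite a3.
apply: (wp_relax_edges s30 adj3 snd3) => s4 _ snd4 rel4 le4.
  split=> //= -[//|l] v; rewrite ltnS => li [x evx wx].
  have [l0|l0] := posnP l.
    rewrite l0 in wx *; apply: leq_trans (le4 v) _.
    by apply: d3 => //; exists x.
  by apply: leq_trans (rel4 _ _ evx) _; rewrite ltnS; apply: d3 wx; lia.
- move=> s3 _ [snd3 d3] ag; apply: fin => // l v ln; apply: d3; lia.
Qed.

End Distances.

(** * Adding a cycle *)

Definition copy (a b : nat) : cmd := for_ 10 (Store b (Var 10) (Cell a (Var 10))).

(* Walking stops on reaching the trial set, which makes that set closed again
   whether or not the walk has returned to its start. *)
Definition follow : cmd :=
  While (Defs.Sub (Const 1) (Cell 5 (Var 7)))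
        (Seq (Store 5 (Var 7) (Const 1))
        (Seq (Assign 9 (Add (Var 9) (Const 1)))
             (Assign 7 (Cell 4 (Var 7))))).

Definition try_add : cmd :=
  Seq distances
 (If (Defs.Sub (Add (Var 0) (Const 1)) (Cell 3 (Var 6)))
     (Seq (copy 2 5)
     (Seq (Assign 9 (Var 8))
     (Seq (Assign 7 (Var 6))
     (Seq follow
          (If (Defs.Sub (Var 9) (Var 1))
              Skip
              (Seq (copy 5 2) (Assign 8 (Var 9))))))))
     Skip).

Section TryAdd.
Variables (n : nat) (e : rel 'I_n) (k : nat).

Definition vset (a : nat -> nat) : {set 'I_n} := [set i : 'I_n | a i != 0].

Lemma vset_upd (a : nat -> nat) (v : 'I_n) :
  vset (fun j => if j == v then 1 else a j) = v |: vset a.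
Proof. by apply/setP => w; rewrite !inE -val_eqE /=; case: (_ == v :> nat). Qed.

Definition succ_closed (S : {set 'I_n}) : Prop :=
  forall v, v \in S -> exists2 w, w \in S & e v w.

Definition solution (s : state) : Prop :=
  [/\ succ_closed (vset (arr s 2)), var s 8 = #|vset (arr s 2)|
    & #|vset (arr s 2)| <= k].

Lemma wp_copy a b (Q : state -> Prop) s :
    a != b -> var s 0 = n ->
    (forall s', agree (copy a b) s s' -> vset (arr s' b) = vset (arr s a) ->
       Q s') ->
  wp n (copy a b) Q s.
Proof.
move=> ab s0 fin.
apply: (wp_for (I := fun i s1 => forall v : 'I_n, v < i ->
  arr s1 b v = arr s a v)) => //.
  move=> i s1 [_ aga] s1x I1; apply: wp_store => v /=.
  rewrite s1x eqxx /= ltnS leq_eqVlt aga /= ?orbF //.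
  by case: eqP => [->|_ /I1].
by move=> s1 ag I1; apply: fin => //; apply/setP => v; rewrite !inE I1.
Qed.

(** Each added vertex is new and is paid for by a drop of the distance label, so at most [arr s 3 u]
    vertices are added, and none if [u] is already present. On stopping, the walker lies in the
    trial set, which provides the successor of the last added vertex. *)
Lemma wp_follow (u : 'I_n) (Q : state -> Prop) s :
    sound e u (arr s 3) (arr s 4) -> arr s 3 u <= n -> var s 7 = u ->
    succ_closed (vset (arr s 5)) -> var s 9 = #|vset (arr s 5)| ->
    (forall s', agree follow s s' -> succ_closed (vset (arr s' 5)) ->
       u |: vset (arr s 5) \subset vset (arr s' 5) ->
       var s' 9 = #|vset (arr s' 5)| ->
       var s' 9 <= var s 9 + (u \notin vset (arr s 5)) * arr s 3 u -> Q s') ->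
  wp n follow Q s.
Proof.
move=> [D0 snd] Du s7 clos s9 fin.
pose S := vset (arr s 5).
pose bound := var s 9 + (u \notin S) * arr s 3 u.
(* For closure the walker [x] is counted as present. The potential [var s1 9 + arr s 3 x] stays
   within [bound] until [x] is in the trial set. *)
apply: (wp_while (I := fun i s1 => exists2 x : 'I_n,
  [/\ var s1 7 = x, arr s 3 x <= n, i <= var s1 9,
      var s1 9 = #|vset (arr s1 5)| & S \subset vset (arr s1 5)] &
  [/\ forall v, v \in vset (arr s1 5) ->
         exists2 w, w \in x |: vset (arr s1 5) & e v w,
      u \in x |: vset (arr s1 5), var s1 9 <= bound &
      x \in vset (arr s1 5) \/ var s1 9 + arr s 3 x <= bound])).
- exists u; split; rewrite ?subxx ?setU11 ?leq_addr //.
    by move=> v /clos[w wS evw]; exists w; rewrite // inE wS orbT.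
  by rewrite /bound /S; case: (u \in _); [left|right; rewrite /= mul1n].
- move=> i s1 ag [x [s17 Dx i9 s19 sub] [clos1 u1 b9 alt]] /=.
  rewrite s17 => x5.
  have xS : x \notin vset (arr s1 5) by rewrite inE; lia.
  have {alt}bx : var s1 9 + arr s 3 x <= bound by case: alt xS => // ->.
  have [y Ny /andP[exy yD]] := snd x Dx.
  split.
    (* The iteration count is at most the size of the trial set, which is below [n] because [x] is
       outside it. *)
    have := subset_leq_card (subsetT (x |: vset (arr s1 5))).
    rewrite cardsU1 xS cardsT card_ord -s19 /=; lia.
  apply/wp_seq/wp_store/wp_seq/wp_assign/wp_assign => /=.
  have -> : arr s1 4 = arr s 4 by case: ag => _ -> //.
  exists y; rewrite /= s17.
    rewrite vset_upd cardsU1 xS -s19 /=; split=> //; try lia.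
      case/orP: yD => [/eqP ->|yD]; lia.
    by apply: subset_trans sub (subsetU1 _ _).
  rewrite vset_upd; split=> [v|||].
  + rewrite in_setU1 => /orP[/eqP ->|/clos1[w wS evw]].
      by exists y; rewrite ?setU11.
    by exists w; rewrite // inE wS orbT.
  + by rewrite inE u1 orbT.
  + by have := D0 x; lia.
  + case/orP: yD => [/eqP ->|yD]; [by left|right; lia].
- move=> i s1 ag [x [s17 Dx i9 s19 sub] [clos1 u1 b9 alt]] /=.
  rewrite s17 => x5.
  have xS : x \in vset (arr s1 5) by rewrite inE; lia.
  have xU : x |: vset (arr s1 5) = vset (arr s1 5).
    by apply/setUidPr; rewrite sub1set.
  rewrite xU in u1 clos1.
  by apply: fin => //; rewrite subUset sub1set u1.
Qed.

(** The label of [u] is at most the length [l] of any closed walk through [u] with [l <= n]. Hence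
    the cost and rejection bounds hold for every such [l], whichever cycle the algorithm follows. *)
Lemma wp_try_add (u : 'I_n) (Q : state -> Prop) s :
    var s 0 = n -> var s 1 = k -> adjacency e s -> var s 6 = u ->
    solution s ->
    (forall s', agree try_add s s' -> solution s' ->
       vset (arr s 2) \subset vset (arr s' 2) ->
       (forall l, 0 < l <= n -> walk e l u u ->
          var s' 8 <= var s 8 + (u \notin vset (arr s 2)) * l /\
          (u \in vset (arr s' 2) \/ k < var s 8 + l)) -> Q s') ->
  wp n try_add Q s.
Proof.
move=> s0 s_k adj s6 sol fin; apply: wp_agree; apply: wp_seq.
apply: (wp_distances s0 adj s6) => s1 ag1 snd1 d1.
have s10 : var s1 0 = n by case: ag1 => -> //.
have s11 : var s1 1 = k by case: ag1 => -> //.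
have s16 : var s1 6 = u by case: ag1 => -> //.
have s18 : var s1 8 = var s 8 by case: ag1 => -> //.
have a12 : arr s1 2 = arr s 2 by case: ag1 => _ -> //.
apply: wp_if => /=; rewrite s10 s16 => Du; last first.
  (* An infinite label at [u] excludes closed walks of length at most [n], so the claim about [l] is
     vacuous. *)
  apply: wp_skip => ag; apply: fin => //; rewrite /solution ?a12 ?s18 //.
  by move=> l ln wl; have := d1 l u ln wl; lia.
apply: wp_seq; apply: (wp_copy (isT : 2 != 5) s10) => s2 ag2 S2.
rewrite a12 in S2.
have s28 : var s2 8 = var s 8 by case: ag2 => -> //.
have s26 : var s2 6 = u by case: ag2 => -> //.
do 2!apply/wp_seq/wp_assign => /=; apply: wp_seq.
case: (sol) => clos cardS leS.
have [a23 a24] : arr s2 3 = arr s1 3 /\ arr s2 4 = arr s1 4.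
  by case: ag2 => _ ag2; split; rewrite ag2.
apply: (@wp_follow u) => //=; rewrite ?s28 ?S2 ?a23 ?a24 //; first by lia.
move=> s3 ag3 clos3 sub3 s39 b3.
have [s30 s31 s38] : [/\ var s3 0 = n, var s3 1 = k & var s3 8 = var s 8].
  by case: ag3 => ag3 _; case: ag2 => ag2 _; split; rewrite ag3 //= ag2.
have a32 : arr s3 2 = arr s 2.
  by case: ag3 => _ -> //=; case: ag2 => _ -> //.
have {}b3 l : 0 < l <= n -> walk e l u u ->
    var s3 9 <= var s 8 + (u \notin vset (arr s 2)) * l.
  move=> ln wl; apply: leq_trans b3 _.
  by rewrite leq_add2l leq_mul2l d1 ?orbT.
move: sub3; rewrite subUset sub1set => /andP[u3 sub3].
apply: wp_if => /=; rewrite s39 s31 => le3.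
  apply: wp_skip => ag; apply: fin => //; rewrite /solution ?a32 ?s38 //.
  move=> l ln wl; split; first by lia.
  by right; have := b3 l ln wl; case: (u \in _) => /=; lia.
apply: wp_seq; apply: (wp_copy (isT : 5 != 2) s30) => s4 ag4 S4.
apply: wp_assign => /= ag.
have s49 : var s4 9 = var s3 9 by case: ag4 => -> //.
apply: fin => //=; rewrite /solution /= ?S4 ?s49 //.
- by split=> //; lia.
- by move=> l ln wl; split; [exact: b3|left].
Qed.

End TryAdd.

(** * Closing under predecessors, and loops at sinks *)

Definition grow_edge : cmd :=
  If (Cell 2 (Var 3))
     (If (Cell 2 (Var 2))
         Skip
         (If (Defs.Sub (Var 1) (Var 8))
             (Seq (Store 2 (Var 2) (Const 1))
                  (Assign 8 (Add (Var 8) (Const 1))))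
             Skip))
     Skip.

Definition grow : cmd := for_ 5 (edges grow_edge).

Definition loop_sinks : cmd :=
  Seq (Assign 4 (Const 0))
      (for_ 2 (Seq (Assign 12 (Const 0))
              (Seq (for_ 3 (If (Cell 0 (Add (Var 4) (Var 3)))
                               (Assign 12 (Const 1))
                               Skip))
              (Seq (If (Var 12) Skip (Store 0 (Add (Var 4) (Var 2)) (Const 1)))
                   (Assign 4 (Add (Var 4) (Var 0))))))).

Lemma row_major_inj n (v w v' w' : 'I_n) :
  v * n + w = v' * n + w' -> v = v' /\ w = w'.
Proof.
move=> eq_idx; have n0 : 0 < n by apply: leq_ltn_trans (ltn_ord v).
have /= := congr1 (fun x => x %/ n) eq_idx.
rewrite !divnMDl // !divn_small ?ltn_ord // !addn0 => /val_inj vv'.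
by split=> //; apply/val_inj/(@addnI (v * n)); rewrite /= {2}vv'.
Qed.

Section Grow.
Variables (n : nat) (e : rel 'I_n) (k : nat).

(** A vertex is added because of an edge into the set, so closure is never lost. A skipped
    predecessor shows that the capacity is exhausted, and this lasts because the size never
    drops. *)
Lemma wp_grow_edges (Q : state -> Prop) s :
    var s 0 = n -> var s 1 = k -> adjacency e s -> solution e k s ->
    (forall s', agree (edges grow_edge) s s' -> solution e k s' ->
       vset n (arr s 2) \subset vset n (arr s' 2) ->
       k <= var s' 8 \/ (forall v w, e v w -> w \in vset n (arr s 2) ->
                           v \in vset n (arr s' 2)) -> Q s') ->
  wp n (edges grow_edge) Q s.
Proof.
move=> s0 s_k adj sol fin.
pose S := vset n (arr s 2).
apply: (wp_edges (J := fun s1 => solution e k s1 /\ S \subset vset n (arr s1 2))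
  (settled := fun v w s1 => w \in S -> k <= var s1 8 \/ v \in vset n (arr s1 2))
  _ _ s0 adj) => //.
- by move=> x; rewrite !inE => /or4P[] /eqP ->.
- by move=> x a s1; rewrite !inE => /or3P[] /eqP ->.
- by move=> x a v w s1; rewrite !inE => /or3P[] /eqP ->.
- move=> v w s1 evw ag s12 s13 [sol1 sub1].
  have s11 : var s1 1 = k by case: ag => -> //.
  case: (sol1) => clos1 s18 le1.
  apply: wp_if => /=; rewrite s13 => w1; last first.
    apply: wp_skip; split=> // wS.
    by have := subsetP sub1 _ wS; rewrite inE w1.
  apply: wp_if => /=; rewrite s12 => v1.
    by apply: wp_skip; split=> // _; right; rewrite inE.
  apply: wp_if => /=; rewrite s11 => lt1; last first.
    by apply: wp_skip; split=> // _; left; lia.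
  have vS : v \notin vset n (arr s1 2) by rewrite inE v1.
  apply/wp_seq/wp_store/wp_assign; rewrite /= s12 /solution /= !vset_upd.
  have cardU : #|v |: vset n (arr s1 2)| = var s1 8 + 1.
    by rewrite cardsU1 vS s18 addnC.
  split=> [|_|v' w' d /d [le8|v'1]].
  + split; last by apply: subset_trans sub1 (subsetU1 _ _).
    split; rewrite ?cardU //; last by lia.
    move=> x; rewrite in_setU1 => /orP[/eqP ->|/clos1[y yS exy]].
      by exists w => //; rewrite !inE w1 orbT.
    by exists y; rewrite // inE yS orbT.
  + by right; rewrite setU11.
  + by left; lia.
  + by right; rewrite inE v'1 orbT.
- move=> s1 ag [sol1 sub1] d1; apply: fin => //.
  have [le|lt] := leqP k (var s1 8); [by left|right=> v w evw wS].
  by case: (d1 v w evw wS) => //; lia.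
Qed.

Lemma wp_grow (Q : state -> Prop) s :
    var s 0 = n -> var s 1 = k -> adjacency e s -> solution e k s ->
    (forall s', agree grow s s' -> solution e k s' ->
       vset n (arr s 2) \subset vset n (arr s' 2) ->
       k <= var s' 8 \/ (forall l v w, l <= n -> walk e l v w ->
          w \in vset n (arr s 2) -> v \in vset n (arr s' 2)) -> Q s') ->
  wp n grow Q s.
Proof.
move=> s0 s_k adj sol fin.
pose S := vset n (arr s 2).
apply: (wp_for (I := fun i s1 =>
  [/\ solution e k s1, S \subset vset n (arr s1 2) &
    k <= var s1 8 \/ (forall l v w, l <= i -> walk e l v w ->
          w \in S -> v \in vset n (arr s1 2))])) => //.
- by split=> //; right=> -[|//] v w _ /= ->.
- move=> i s1 ag _ [sol1 sub1 alt1].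
  have s10 : var s1 0 = n by case: ag => -> //.
  have s11 : var s1 1 = k by case: ag => -> //.
  have adj1 : adjacency e s1 by case: ag => _ a1 v w; rewrite a1.
  apply: (wp_grow_edges s10 s11 adj1 sol1) => s2 _ sol2 sub2 alt2.
  split=> //; first exact: subset_trans sub1 sub2.
  case: alt1 => [le|alt1].
    left; case: sol1 => _ s18 _; case: sol2 => _ /= -> _.
    by apply: leq_trans (subset_leq_card sub2); rewrite -s18.
  case: alt2 => [|alt2]; [by left|right=> /= -[|l] v w li].
    move=> /= -> wS; exact/(subsetP sub2)/(subsetP sub1).
  move=> [x evx wlx] wS; apply: alt2 evx _.
  exact: alt1 wlx wS.
- by move=> s1 ag [sol1 sub1 alt1]; apply: fin.
Qed.

Definition add_loops : rel 'I_n :=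
  fun v w => e v w || (v == w) && ~~ [exists x, e v x].

(** Row [i] is scanned completely before its diagonal entry is written, so the flag tests the
    original edges. *)
Lemma wp_loop_sinks (Q : state -> Prop) s :
    var s 0 = n -> adjacency e s ->
    (forall s', agree loop_sinks s s' -> adjacency add_loops s' -> Q s') ->
  wp n loop_sinks Q s.
Proof.
move=> s0 adj fin; apply: wp_agree; apply/wp_seq/wp_assign => /=.
apply: (wp_for (I := fun i s1 => var s1 4 = i * n /\ forall v w : 'I_n,
  (arr s1 0 (v * n + w) != 0) = if v < i then add_loops v w else e v w)) => //.
- move=> i s1 ag1 s12 [s14 A1].
  have s10 : var s1 0 = n by case: ag1 => -> //.
  apply/wp_seq/wp_assign/wp_seq => /=.
  apply: (wp_for (I := fun j s2 => (var s2 12 != 0) =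
    [exists w : 'I_n, (w < j) && e i w])) => //.
  + by apply/esym/negbTE/existsPn.
  + move=> j s2 ag2 s23 I2.
    have s24 : var s2 4 = i * n by case: ag2 => -> //.
    have a20 : arr s2 0 = arr s1 0 by case: ag2 => _ -> //.
    have I3 : [exists w : 'I_n, (w < j.+1) && e i w] =
        [exists w : 'I_n, (w < j) && e i w] || e i j.
      apply/existsP/orP => [[w /andP[]]|[/existsP[w /andP[wj eiw]]|eij]].
      * rewrite ltnS leq_eqVlt => /orP[/eqP/val_inj ->|wj eiw]; first by right.
        by left; apply/existsP; exists w; rewrite wj.
      * by exists w; rewrite eiw andbT ltnW.
      * by exists j; rewrite ltnSn.
    apply: wp_if => /=; rewrite s24 s23 a20 => aij.
      apply: wp_assign => /=; rewrite I3.
      by move: aij; rewrite A1 ltnn => ->; rewrite orbT.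
    apply: wp_skip => /=; rewrite I3 I2.
    by have := A1 i j; rewrite aij ltnn => <-; rewrite orbF.
  + move=> s2 ag2 I2.
    have s24 : var s2 4 = i * n by case: ag2 => -> //.
    have s22 : var s2 2 = i by case: ag2 => -> //.
    have s20 : var s2 0 = n by case: ag2 => -> //.
    have a20 : arr s2 0 = arr s1 0 by case: ag2 => _ -> //.
    have {}I2 : (var s2 12 != 0) = [exists w, e i w].
      by rewrite I2; apply: eq_existsb => w; rewrite ltn_ord.
    have old (v w : 'I_n) : v != i -> (if v < i.+1 then add_loops v w else e v w)
        = (arr s1 0 (v * n + w) != 0).
      move=> vi; rewrite A1 ltnS leq_eqVlt.
      by move: vi; rewrite -val_eqE /= => /negbTE ->.
    apply: wp_seq; apply: wp_if => /=; rewrite ?s24 ?s22 => f12.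
      apply/wp_skip/wp_assign; rewrite /= s24 s20 mulSn addnC; split=> // v w.
      rewrite a20; have [->|/old -> //] := eqVneq v i.
      by rewrite A1 ltnn ltnSn /add_loops -I2 f12 andbF orbF.
    apply/wp_store/wp_assign; rewrite /= s22 s24 s20 mulSn addnC; split=> // v w.
    rewrite a20; have [->|vi] := eqVneq v i.
      rewrite eqn_add2l ltnSn /add_loops -I2 f12 andbT.
      rewrite [i == w]eq_sym -[w == i]val_eqE /=.
      by case: (w == i :> nat); rewrite ?orbT //= A1 ltnn orbF.
    rewrite old //.
    have [/row_major_inj[vi']|//] := eqVneq (v * n + w) (i * n + i).
    by rewrite vi' eqxx in vi.
- move=> s1 _ [_ A1] ag; apply: fin => // v w.
  by rewrite A1 ltn_ord.
Qed.

End Grow.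

(** * One candidate *)

Fixpoint add_guesses (m : nat) : cmd :=
  if m is m'.+1 then
    Seq (add_guesses m') (Seq (Assign 6 (Var (20 + m'))) try_add)
  else Skip.

Definition add_all : cmd := for_ 13 (Seq (Assign 6 (Var 13)) try_add).

Definition candidate (m : nat) : cmd :=
  Seq (for_ 10 (Store 2 (Var 10) (Const 0)))
 (Seq (Assign 8 (Const 0))
 (Seq (add_guesses m)
 (Seq add_all
 (Seq grow
      (If (Defs.Sub (Var 8) (Var 11))
          (Seq (copy 2 1) (Assign 11 (Var 8)))
          Skip))))).

(** What [add_guesses m] writes does not compute for a variable [m]; it is bounded by the writes of
    [try_add] and variable 6. *)
Lemma agree_add_guesses m c s s' :
    (forall x, writes_var try_add x || (x == 6) -> writes_var c x) ->
    (forall a, writes_arr try_add a -> writes_arr c a) ->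
  agree (add_guesses m) s s' -> agree c s s'.
Proof.
move=> sv sa; apply: agree_sub => x; elim: m => //= m ih.
  by case/orP => // h; apply: sv; rewrite orbC.
by case/orP => // h; apply: sa.
Qed.

Section Candidate.
Variables (n : nat) (e : rel 'I_n) (k : nat).

Definition problem (s : state) : Prop :=
  [/\ var s 0 = n, var s 1 = k & adjacency e s].

Lemma problem_agree c s s' :
    ~~ writes_var c 0 -> ~~ writes_var c 1 -> ~~ writes_arr c 0 ->
  agree c s s' -> problem s -> problem s'.
Proof.
by move=> c0 c1 a0 [agv aga] [s0 s1 adj]; split; rewrite ?agv // /adjacency aga.
Qed.

Definition closed_walks (vs : seq ('I_n * nat)) : Prop :=
  forall p, p \in vs -> 0 < p.2 <= n /\ walk e p.2 p.1 p.1.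

(** A core is kept as a vertex and a length only. The cycle that the algorithm finds instead may be
    a different one and need not lie in [U]. *)
Definition cores (U : {set 'I_n}) (vs : seq ('I_n * nat)) : Prop :=
  [/\ closed_walks vs,
      \sum_(p <- vs) p.2 <= #|U| &
      forall x, x \in U ->
        exists2 p, p \in vs & exists2 m, m <= n & walk e m x p.1].

(* Does not increase when a vertex of a core is added together with its cycle, so
   cores that fit together are never rejected while only cores are being
   added. *)
Definition weight (vs : seq ('I_n * nat)) (S : {set 'I_n}) : nat :=
  #|S| + \sum_(p <- vs | p.1 \notin S) p.2.

(** If [p.1] is new, its summand vanishes and pays for the growth of the set; the other summands can
    only vanish. *)
Lemma leq_weight vs (S S' : {set 'I_n}) p :
    p \in vs -> S \subset S' -> #|S'| <= #|S| + (p.1 \notin S) * p.2 ->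
  p.1 \in S' -> weight vs S' <= weight vs S.
Proof.
move=> pvs sub leS pS'; rewrite /weight !(big_rem p pvs) /= pS' /=.
have : \sum_(q <- rem p vs | q.1 \notin S') q.2 <=
       \sum_(q <- rem p vs | q.1 \notin S) q.2.
  rewrite big_mkcond [leqRHS]big_mkcond; apply: leq_sum => q _.
  by have := subsetP sub q.1; case: (q.1 \in S) => [-> //|_]; case: ifP.
by move: leS; case: (p.1 \in S) => /=; lia.
Qed.

(** The result is a solution whatever the guesses are. If all of them are cores, the weight stays at
    most [k], so a core [p] not yet present satisfies [#|S| + p.2 <= k] and cannot be rejected. *)
Lemma wp_add_guesses m s :
    problem s -> solution e k s -> (forall j, j < m -> var s (20 + j) < n) ->
  wp n (add_guesses m) (fun s' => solution e k s' /\
    forall vs, closed_walks vs -> weight vs (vset n (arr s 2)) <= k ->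
      (forall j, j < m -> exists2 p, p \in vs & var s (20 + j) = p.1) ->
      weight vs (vset n (arr s' 2)) <= k /\
      forall j (v : 'I_n), j < m -> var s (20 + j) = v ->
        v \in vset n (arr s' 2)) s.
Proof.
move=> prob sol; elim: m => [|m ih] guessed.
  by apply: wp_skip; split=> // _ w; split.
apply: wp_seq; apply: wp_mono (ih _) => [s1 ag1 [sol1 h1]|j jm]; last first.
  by apply: guessed; rewrite ltnW.
have {}ag1 : agree (Seq (Assign 6 (Const 0)) try_add) s s1.
  by apply: agree_add_guesses ag1 => x //=; rewrite orbC.
have prob1 : problem s1 by apply: problem_agree ag1 prob.
have s1m : var s1 (20 + m) = var s (20 + m) by case: ag1 => ->.
apply/wp_seq/wp_assign => /=; case: (prob1) => s10 s11 adj1.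
apply: (@wp_try_add n e k (Ordinal (guessed m (ltnSn m)))) => //=.
move=> s2 ag2 sol2 sub2 d2; split=> // vs cyc w g.
have [|w1 in1] := h1 _ cyc w; first by move=> j jm; apply: g; rewrite ltnW.
have [p pvs sp] := g m (ltnSn m).
have pE : p.1 = Ordinal (guessed m (ltnSn m)) by apply: val_inj.
have [p2 wp2] := cyc p pvs; rewrite -pE in d2.
have [le2 alt2] := d2 p.2 p2 wp2.
case: sol1 sol2 => _ s18 _ [_ s28 _]; rewrite s18 s28 in le2 alt2.
have in2 : p.1 \in vset n (arr s2 2).
  have [/(subsetP sub2)//|pS] := boolP (p.1 \in vset n (arr s1 2)).
  case: alt2 => // lt; move: w1; rewrite /weight (big_rem p pvs) /= pS.
  by rewrite addnA => /(leq_trans (leq_addr _ _)); rewrite leqNgt lt.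
split=> [|j v]; first exact: leq_trans (leq_weight pvs sub2 le2 in2) w1.
rewrite ltnS leq_eqVlt => /orP[/eqP ->|jm sv]; last exact/(subsetP sub2)/(in1 j).
by rewrite sp => /val_inj <-.
Qed.

(** The inequality behind a rejection concerns the size at that moment; it persists because the size
    only grows. *)
Lemma wp_add_all (Q : state -> Prop) s :
    problem s -> solution e k s ->
    (forall s', agree add_all s s' -> solution e k s' ->
       vset n (arr s 2) \subset vset n (arr s' 2) ->
       (forall u l, 0 < l <= n -> walk e l u u ->
          u \in vset n (arr s' 2) \/ k < var s' 8 + l) -> Q s') ->
  wp n add_all Q s.
Proof.
move=> prob sol fin; case: (prob) => s0 _ _.
apply: (wp_for (I := fun i s1 => [/\ solution e k s1,
  vset n (arr s 2) \subset vset n (arr s1 2) &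
  forall (u : 'I_n) l, u < i -> 0 < l <= n -> walk e l u u ->
    u \in vset n (arr s1 2) \/ k < var s1 8 + l])) => //.
- move=> i s1 ag s1x [sol1 sub1 d1].
  have [s10 s11 adj1] : problem s1 by apply: problem_agree ag prob.
  apply/wp_seq/wp_assign; rewrite /= s1x.
  apply: (@wp_try_add n e k i) => //= s2 _ sol2 sub2 d2.
  have le8 : var s1 8 <= var s2 8.
    by case: sol1 sol2 => _ -> _ [_ -> _]; apply: subset_leq_card.
  split=> [//||u l]; first exact: subset_trans sub1 sub2.
  rewrite ltnS leq_eqVlt => /orP[/eqP/val_inj ->|ui] ln wl.
    by case: (d2 l ln wl) => _ [|lt]; [left|right=> /=; lia].
  case: (d1 u l ui ln wl) => [uS|lt]; [left|right=> /=; lia].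
  exact: (subsetP sub2).
- by move=> s1 ag [sol1 sub1 d1]; apply: fin => // u l; apply: d1.
Qed.

Definition incumbent (s : state) : Prop :=
  [/\ succ_closed e (vset n (arr s 1)), var s 11 = #|vset n (arr s 1)|
    & var s 11 <= k].

(** If all cores are in [S], then [S'] contains [U] or has size at least [k]. Otherwise a missing
    core [p] has [k < #|S| + p.2] and [m * p.2 <= k]; multiplying the former by [m] gives
    [m * k <= m * #|S'| + k]. *)
Lemma candidate_bound m (U S S' : {set 'I_n}) vs :
    0 < m -> #|U| <= k -> cores U vs -> S \subset S' ->
    (forall p, p \in vs -> p.1 \in S \/ k < #|S| + p.2) ->
    (forall p, p \in vs -> k < m * p.2 -> p.1 \in S) ->
    (k <= #|S'| \/ forall l v w, l <= n -> walk e l v w -> w \in S -> v \in S') ->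
  m.-1 * #|U| <= m * #|S'|.
Proof.
move=> m0 Uk [cyc _ reach] sub small large grown.
have leS := subset_leq_card sub.
have [vsS|] := boolP (all (fun p => p.1 \in S) vs).
  suff leU : #|U| <= #|S'| by apply: leq_mul (leq_pred m) leU.
  case: grown => [|grown]; first exact: leq_trans Uk.
  apply/subset_leq_card/subsetP => x /reach[p pvs [l ln wl]].
  exact: grown wl (allP vsS p pvs).
case/allPn => p pvs pS.
case: (small p pvs) => [|lt]; first by rewrite (negbTE pS).
have le_p : m * p.2 <= k.
  by rewrite leqNgt; apply: contra pS; apply: large.
apply: (@leq_trans (m.-1 * k)); first by rewrite leq_mul2l Uk orbT.
have lt_m : m * k <= m * #|S'| + m * p.2.
  rewrite -mulnDr leq_mul2l; apply/orP; right.
  by apply: leq_trans (ltnW lt) _; rewrite leq_add2r.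
rewrite -(leq_add2r k) -mulSnr prednK //; apply: leq_trans lt_m _.
by rewrite leq_add2l.
Qed.

Lemma wp_candidate m s :
    0 < m -> problem s -> incumbent s ->
    (forall j, j < m -> var s (20 + j) < n) ->
  wp n (candidate m) (fun s' => [/\ problem s', incumbent s',
    var s 11 <= var s' 11 &
    forall (U : {set 'I_n}) vs, #|U| <= k -> cores U vs ->
      (forall j, j < m -> exists2 p, p \in vs & var s (20 + j) = p.1) ->
      (forall p, p \in vs -> k < m * p.2 ->
         exists2 j, j < m & var s (20 + j) = p.1) ->
      m.-1 * #|U| <= m * var s' 11]) s.
Proof.
move=> m0 prob inc guessed; case: (prob) => s0 _ _.
apply: wp_seq; apply: (wp_for (I := fun i s1 =>
  forall v : 'I_n, v < i -> arr s1 2 v = 0)) => //.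
  move=> i s1 _ s1x I1; apply: wp_store => v /=.
  by rewrite s1x ltnS leq_eqVlt; case: eqP => [//|_ /I1].
move=> s1 ag1 I1; apply/wp_seq/wp_assign => /=.
set s1' := set_var s1 8 0.
have S1 : vset n (arr s1' 2) = set0.
  by apply/setP => v; rewrite !inE I1 // eqxx.
have sol1 : solution e k s1'.
  by rewrite /solution S1 cards0; split=> // v; rewrite inE.
have prob1 : problem s1' by apply: (problem_agree _ _ _ ag1) prob.
have guess1 j : var s1' (20 + j) = var s (20 + j).
  by case: ag1 => agv _; exact: (agv (20 + j) isT).
have s1_11 : var s1' 11 = var s 11 by case: ag1 => agv _; exact: (agv 11 isT).
have a1_1 : arr s1' 1 = arr s 1 by case: ag1 => _ aga; exact: (aga 1 isT).
apply: wp_seq; apply: wp_mono (wp_add_guesses (m := m) prob1 sol1 _); last first.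
  by move=> j; rewrite guess1; apply: guessed.
rewrite S1 => s2 ag2 [sol2 h2].
have {}ag2 : agree (Seq (Assign 6 (Const 0)) try_add) s1' s2.
  by apply: agree_add_guesses ag2 => x //=; rewrite orbC.
have prob2 : problem s2 by apply: problem_agree ag2 prob1.
apply: wp_seq; apply: wp_add_all => // s3 ag3 sol3 sub3 h3.
have prob3 : problem s3 by apply: problem_agree ag3 prob2.
case: (prob3) => s30 s31 adj3.
apply: wp_seq; apply: (wp_grow s30 s31 adj3 sol3) => s4 ag4 sol4 sub4 h4.
have prob4 : problem s4 by apply: problem_agree ag4 prob3.
have s4_11 : var s4 11 = var s 11.
  case: ag4 => -> // _; case: ag3 => -> // _.
  by case: ag2 => -> // _.
have a4_1 : arr s4 1 = arr s 1.
  case: ag4 => _ -> //; case: ag3 => _ -> //.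
  by case: ag2 => _ -> //.
case: (sol4) => clos4 s48 le4; case: (sol3) => _ s38 _.
have bound (U : {set 'I_n}) vs : #|U| <= k -> cores U vs ->
      (forall j, j < m -> exists2 p, p \in vs & var s (20 + j) = p.1) ->
      (forall p, p \in vs -> k < m * p.2 ->
         exists2 j, j < m & var s (20 + j) = p.1) ->
      m.-1 * #|U| <= m * var s4 8.
  move=> Uk cUvs g big; rewrite s48.
  case: (cUvs) => cyc wU _.
  (* From the empty set, the initial weight is the total length of the cores, at most [#|U|]. *)
  have [||_ in2] := h2 vs cyc.
  - rewrite /weight cards0; apply: leq_trans Uk; apply: leq_trans wU.
    by rewrite leq_eqVlt; apply/orP; left; apply/eqP/eq_bigl => p; rewrite inE.
  - by move=> j jm; rewrite guess1; apply: g.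
  apply: candidate_bound sub4 _ _ _ => //.
  - exact: cUvs.
  - by move=> p /cyc[p2 wp2]; rewrite -s38; apply: h3 wp2.
  - move=> p pvs /big[//|j jm sj]; apply/(subsetP sub3)/(in2 j) => //.
    by rewrite guess1.
  - by rewrite -s48.
case: inc => clos1 s11 le11.
apply: wp_if => /=; rewrite s4_11 => lt; last first.
  apply: wp_skip; split=> //; first by rewrite /incumbent s4_11 a4_1.
    by rewrite s4_11.
  move=> U vs Uk c g b; apply: leq_trans (bound U vs Uk c g b) _.
  by rewrite leq_mul2l s4_11; apply/orP; right; lia.
case: (prob4) => s40 _ _.
apply: wp_seq; apply: (wp_copy (isT : 2 != 1) s40) => s5 ag5 S5.
have s58 : var s5 8 = var s4 8 by case: ag5 => ->.
apply: wp_assign; split=> /=.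
- exact: (problem_agree _ _ _ ag5 prob4).
- by rewrite /incumbent /= S5 s58 s48.
- by rewrite s58; lia.
- by rewrite s58.
Qed.

End Candidate.

(** * Guessing, and the cores of an optimal solution *)

Fixpoint guess (m : nat) (body : cmd) : cmd :=
  if m is m'.+1 then for_ (20 + m') (guess m' body) else body.

Definition ptas (m : nat) : cmd := Seq loop_sinks (guess m (candidate m)).

(** Each further guess adds one loop and one [try_add], hence a constant, to the exponent. *)
Lemma cost_exp_ptas : exists C, forall m, cost_exp (ptas m) <= C * m.+1.
Proof.
pose a := cost_exp try_add + 4; pose b := cost_exp (candidate 0).
pose d := cost_exp (for_ 0 Skip).
have Ea m : cost_exp (add_guesses m) = a * m.
  elim: m => [|m ih]; first by rewrite muln0.
  rewrite mulnS -ih /a.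
  suff -> : cost_exp (add_guesses m.+1) =
    (cost_exp (add_guesses m) + (2 + cost_exp try_add).+1).+1 by lia.
  by [].
have Eb m : cost_exp (candidate m) = a * m + b.
  by rewrite -Ea /b [cost_exp (candidate _)]/= [RHS]/=; lia.
have Ed m c : cost_exp (guess m c) = cost_exp c + d * m.
  elim: m => [|m ih]; first by rewrite muln0 addn0.
  rewrite mulnS [cost_exp _]/= ih /d [cost_exp (for_ _ _)]/=; lia.
exists (a + b + d + (cost_exp loop_sinks).+1) => m.
have -> : cost_exp (ptas m) =
  (cost_exp loop_sinks + cost_exp (guess m (candidate m))).+1 by [].
rewrite Ed Eb; move: (cost_exp loop_sinks) => q; clear Ea Eb Ed.
by clearbody a b d; nia.
Qed.

Section Guess.
Variables (n m : nat) (body : cmd) (inv good : state -> Prop) (g : nat -> nat).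

Hypotheses
  (body0 : ~~ writes_var body 0)
  (bodyg : forall j, ~~ writes_var body (20 + j))
  (inv0 : forall s, inv s -> var s 0 = n)
  (inv_set : forall s j a, inv s -> inv (set_var s (20 + j) a))
  (good_set : forall s j a, good s -> good (set_var s (20 + j) a))
  (bodyP : forall s, inv s -> (forall j, j < m -> var s (20 + j) < n) ->
     wp n body (fun s' => [/\ inv s', good s -> good s' &
       (forall j, j < m -> var s (20 + j) = g j) -> good s']) s).

Lemma writes_var_guess i x :
  (x < 20) || (20 + i <= x) -> writes_var (guess i body) x = writes_var body x.
Proof.
elim: i => // i ih xi; rewrite /= ih; last by lia.
by have -> : (x == 20 + i) = false by [lia]; rewrite orbF.
Qed.

(** The outer variables, those with [i <= j], are fixed while the [i] inner loops run. [g] is the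
    tuple to be hit; once [good] holds, no later iteration destroys it. *)
Lemma wp_guess_from i s :
    i <= m -> inv s -> (forall j, i <= j < m -> var s (20 + j) < n) ->
  wp n (guess i body) (fun s' => [/\ inv s', good s -> good s' &
    (forall j, j < m -> g j < n) ->
    (forall j, i <= j < m -> var s (20 + j) = g j) -> good s']) s.
Proof.
elim: i s => [|i ih] s im inv_s lt_s.
  by apply: wp_mono (bodyP inv_s lt_s) => s' _ [? ? good']; split.
(* [g i < x] says that this loop has already passed the right value. *)
apply: (wp_for (I := fun x s1 => [/\ inv s1, good s -> good s1 &
   (forall j, j < m -> g j < n) ->
   (forall j, i < j < m -> var s (20 + j) = g j) -> g i < x -> good s1])) => //.
- by rewrite writes_var_guess.
- by rewrite writes_var_guess ?leqnn ?orbT.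
- exact: inv0.
- by split=> [|/good_set //|//]; exact: inv_set.
- move=> x s1 ag s1x [inv1 mono1 good1].
  have same j : i < j -> var s1 (20 + j) = var s (20 + j).
    move=> ij; case: ag => -> //=; rewrite writes_var_guess; last by lia.
    by rewrite (negbTE (bodyg j)); lia.
  apply: wp_mono (ih s1 _ inv1 _); first last.
  + move=> j /andP[]; rewrite leq_eqVlt => /orP[/eqP <- _|ij jm].
      by rewrite s1x.
    by rewrite same // lt_s // ij.
  + exact: ltnW.
  move=> s2 _ [inv2 mono2 good2]; split; first exact: inv_set.
    by move=> gs; apply/good_set/mono2/mono1.
  move=> g_lt eq_g; rewrite ltnS leq_eqVlt => /orP[/eqP gx|gx].
    apply/good_set/good2 => // j /andP[]; rewrite leq_eqVlt => /orP[/eqP <- _|ij jm].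
      by rewrite s1x gx.
    by rewrite same // eq_g // ij.
  exact/good_set/mono2/good1.
- move=> s1 _ [inv1 mono1 good1]; split=> // g_lt eq_g.
  by apply: good1 eq_g _ => //; apply: g_lt.
Qed.

Lemma wp_guess s :
    inv s -> good s \/ (forall j, j < m -> g j < n) ->
  wp n (guess m body) (fun s' => inv s' /\ good s') s.
Proof.
move=> inv_s ok; apply: wp_mono (wp_guess_from (leqnn m) inv_s _) => [|j]; last lia.
move=> s' _ [inv' mono good']; split=> //; case: ok => [/mono //|g_lt].
by apply: good' => // j; lia.
Qed.

End Guess.

(** * Cores of a successor-closed set *)

Section Cores.
Variables (n : nat) (e : rel 'I_n).

Lemma walk_iter (f : 'I_n -> 'I_n) (U : {set 'I_n}) x l :
    (forall y, y \in U -> f y \in U /\ e y (f y)) -> x \in U ->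
  walk e l x (iter l f x).
Proof.
move=> fU; elim: l x => //= l ih x xU; have [fxU exf] := fU x xU.
by exists (f x) => //; rewrite -iterS iterSr; apply: ih.
Qed.

Lemma iter_in (f : 'I_n -> 'I_n) (U : {set 'I_n}) x l :
  (forall y, y \in U -> f y \in U) -> x \in U -> iter l f x \in U.
Proof. by move=> fU xU; elim: l => //= l; apply: fU. Qed.

(** Induction on [#|W|]: the orbit of a point ends in a cycle through some [y]. Its basin [B] in [W]
    contains the cycle, so the period is at most [#|B|], and the rest [W :\: B] is again stable
    under [f]. *)
Lemma periodic_points (f : 'I_n -> 'I_n) (W : {set 'I_n}) :
    (forall y, y \in W -> f y \in W) ->
  exists vs : seq ('I_n * nat),
    [/\ forall p, p \in vs -> [/\ p.1 \in W, 0 < p.2 <= n & iter p.2 f p.1 = p.1],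
        \sum_(p <- vs) p.2 <= #|W| &
        forall x, x \in W -> exists2 p, p \in vs & fconnect f x p.1].
Proof.
have [b] := ubnP #|W|; elim: b W => // b ih W Wb fW.
have [->|/set0Pn[x xW]] := eqVneq W set0.
  by exists [::]; split=> [//||x]; rewrite ?big_nil ?inE.
(* [i] is the preperiod of [x], and [order f x - i] the period of its cycle. *)
have /trajectP[i lti xi] := looping_order f x.
pose y := iter i f x; pose l := order f x - i.
have yl : iter l f y = y by rewrite /y /l -iterD subnK // ltnW.
have yW : y \in W by apply: iter_in.
pose B := [set z in W | fconnect f z y].
have leB : l <= #|B|.
  rewrite -(size_traject f y l) cardE; apply: uniq_leq_size.
    have := orbit_uniq f x; rewrite /orbit.
    rewrite -(subnKC (ltnW lti)) -/l trajectD -/y cat_uniq.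
    by case/and3P.
  move=> z /trajectP[j jl ->]; rewrite mem_enum inE iter_in //=.
  have {2}<- : iter (l - j) f (iter j f y) = y by rewrite -iterD subnK // ltnW.
  exact: fconnect_iter.
have l0 : 0 < l by rewrite subn_gt0.
have ln : l <= n.
  by apply: leq_trans leB _; rewrite -[leqRHS]card_ord max_card.
have BW : B \subset W by apply/subsetP => z; rewrite inE => /andP[].
have WB : #|W :\: B| + #|B| = #|W|.
  by rewrite cardsD (setIidPr BW) subnK // subset_leq_card.
have [||vs [cyc sum reach]] := ih (W :\: B); first by lia.
  move=> z; rewrite !inE => /andP[zB zW]; rewrite zW /= in zB.
  (* A point whose image lies in the basin lies in the basin itself. *)
  by rewrite fW // andbT /=; apply: contra zB; apply: connect_trans (fconnect1 f z).
exists ((y, l) :: vs); split=> [p|| z zW].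
- rewrite inE => /orP[/eqP -> //=|/cyc[]]; first by rewrite l0.
  by rewrite inE => /andP[_ pW].
- by rewrite big_cons -WB addnC leq_add.
- have [zB|zB] := boolP (z \in B).
    by exists (y, l); [rewrite mem_head|move: zB; rewrite inE => /andP[]].
  have [|p pvs zp] := reach z; first by rewrite inE zB.
  by exists p; rewrite // inE pvs orbT.
Qed.

(** Fix one successor inside [U] for each vertex of [U] and take the cycles of the resulting map. *)
Lemma cores_exist (U : {set 'I_n}) : succ_closed e U -> exists vs, cores e U vs.
Proof.
move=> clos; pose f v := odflt v [pick w in U | e v w].
have fU y : y \in U -> f y \in U /\ e y (f y).
  move=> /clos[w wU eyw]; rewrite /f; case: pickP => [z /andP[]//|/(_ w)].
  by rewrite wU eyw.
have [y yU|vs [cyc sum reach]] := @periodic_points f U; first by case: (fU y yU).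
exists vs; split=> // [p /cyc[pU p2 it]|x xU].
  by split=> //; rewrite -{2}it; apply: walk_iter fU pU.
have [p pvs xp] := reach x xU; exists p => //; exists (findex f x p.1).
  apply: ltnW; apply: leq_trans (findex_max xp) _.
  by rewrite -[leqRHS]card_ord max_card.
by rewrite -{2}(iter_findex xp); apply: walk_iter fU xU.
Qed.

End Cores.

(** * Correctness of the scheme *)

Section Ptas.
Variables (n : nat) (E : rel 'I_n) (k : nat).

Lemma adjacency_input : adjacency E (input E k).
Proof.
move=> v w /=; rewrite eqb0 negbK.
apply/existsP/idP => [[i /existsP[j /andP[/eqP/row_major_inj[-> ->]]]] //|Evw].
by exists v; apply/existsP; exists w; rewrite eqxx.
Qed.

Lemma feasibleP (U : {set 'I_n}) :
  reflect (#|U| <= k /\ succ_closed (add_loops E) U) (feasible E k U).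
Proof.
apply: (iffP andP) => -[Uk clos]; split=> //.
  move=> v vU; have := forall_inP clos v vU.
  have [_ /exists_inP[w wU Evw]|noE _] := boolP [exists w, E v w].
    by exists w; rewrite // /add_loops Evw.
  by exists v; rewrite // /add_loops eqxx noE orbT.
apply/forall_inP => v vU; apply/implyP => Ev.
have [w wU] := clos v vU; rewrite /add_loops Ev andbF orbF => Evw.
by apply/exists_inP; exists w.
Qed.

(** Every heavy core contributes at least [k.+1] to [m] times the total length, which is at most
    [m * k]. *)
Lemma sum_heavy m (vs : seq ('I_n * nat)) :
    \sum_(p <- vs) p.2 <= k ->
  size [seq p <- vs | k < m * p.2] <= m.
Proof.
move=> sum_k; rewrite leqNgt; apply/negP => lt_m.
have heavy : size [seq p <- vs | k < m * p.2] * k.+1 <= m * \sum_(p <- vs) p.2.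
  rewrite size_filter; elim: vs {sum_k lt_m} => [|p vs ih]; first by rewrite big_nil.
  by rewrite big_cons /= mulnDl mulnDr leq_add //; case: ltnP => //; lia.
have := leq_trans heavy (leq_mul (leqnn m) sum_k).
by have := leq_mul lt_m (leqnn k.+1); lia.
Qed.

(** The heavy cores are listed first and the tuple is padded with an arbitrary core [p0], since
    every guess has to be a core. A nonempty [U] supplies [p0]. *)
Lemma guessable m (U : {set 'I_n}) (vs : seq ('I_n * nat)) :
    #|U| <= k -> 0 < #|U| -> cores (add_loops E) U vs ->
  exists g : nat -> nat,
    (forall j, exists2 p, p \in vs & g j = p.1) /\
    (forall p, p \in vs -> k < m * p.2 -> exists2 j, j < m & g j = p.1).
Proof.
move=> Uk /card_gt0P[x xU] [_ sum_U reach].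
have [p0 p0vs _] := reach x xU.
pose heavy := [seq p <- vs | k < m * p.2].
exists (fun j => nat_of_ord (nth p0 heavy j).1); split=> [j|p pvs pk].
  have [lt|ge] := ltnP j (size heavy); last by exists p0; rewrite ?nth_default.
  exists (nth p0 heavy j) => //.
  by have := mem_nth p0 lt; rewrite mem_filter => /andP[].
have ph : p \in heavy by rewrite mem_filter pk.
exists (index p heavy); last by rewrite nth_index.
apply: leq_trans (sum_heavy m (leq_trans sum_U Uk)).
by rewrite index_mem.
Qed.

Lemma ptas_correct m : 0 < m ->
  exists s t, [/\ exec (ptas m) (input E k) s t, feasible E k (output n s),
    m.-1 * opt E k <= m * #|output n s| & t <= maxn n 2 ^ cost_exp (ptas m)].
Proof.
move=> m0; pose e := add_loops E.
suff [s [t [ex le_t [feas good]]]] : wp n (ptas m) (fun s =>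
    feasible E k (output n s) /\ m.-1 * opt E k <= m * #|output n s|)
    (input E k) by exists s, t.
have [U /feasibleP[Uk clos] ->] : exists2 U, feasible E k U & opt E k = #|U|.
  rewrite /opt; have [|U] := @eq_bigmax_cond _ (feasible E k) (fun U => #|U|).
    apply/card_gt0P; exists set0; apply/feasibleP; split; rewrite ?cards0 //.
    by move=> v; rewrite inE.
  by exists U.
have [vs cUvs] := cores_exist clos.
apply: wp_seq; apply: (wp_loop_sinks _ adjacency_input) => // s1 ag1 adj1.

have prob1 : problem e k s1 by case: ag1 => agv _; split=> //; rewrite agv.
have inc1 : incumbent e k s1.
  have out0 : vset n (arr s1 1) = set0.
    by apply/setP => v; case: ag1 => _ aga; rewrite !inE aga.
  by case: ag1 => agv _; split; rewrite ?out0 ?agv ?cards0 // => v; rewrite inE.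
pose inv s := problem e k s /\ incumbent e k s.
pose good s := m.-1 * #|U| <= m * var s 11.
have fin s : inv s -> good s ->
    feasible E k (output n s) /\ m.-1 * #|U| <= m * #|output n s|.
  move=> [_ [clos_s s11 le11]]; rewrite /good s11 => good_s; split=> //.
  by apply/feasibleP; rewrite -s11.
(* An empty optimum needs no correct guess, and there may then be no vertex to guess. *)
have [g [g_lt gP]] : exists g : nat -> nat,
    (#|U| = 0 \/ forall j, g j < n) /\
    (0 < #|U| -> (forall j, exists2 p, p \in vs & g j = p.1) /\
      (forall p, p \in vs -> k < m * p.2 -> exists2 j, j < m & g j = p.1)).
  have [U0|U0] := posnP #|U|; first by exists (fun=> 0); split; [left|].
  have [g [g_vs g_heavy]] := guessable m Uk U0 cUvs; exists g; split=> //.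
  by right=> j; have [p _ ->] := g_vs j.
suff best : wp n (guess m (candidate m)) (fun s => inv s /\ good s) s1.
  by apply: wp_mono best => s _ [inv_s good_s]; apply: fin.
apply: (@wp_guess n m (candidate m) inv good g).
- have : ~~ writes_var (add_guesses m) 0 by elim: (m) => //= i /negbTE ->.
  by rewrite /= => /negbTE ->.
- move=> j; have : ~~ writes_var (add_guesses m) (20 + j) by elim: (m) => //= i /negbTE ->.
  by rewrite /= => /negbTE ->.
- by move=> s [[]].
- by move=> s j a [[s0 sk adj] [clos_s s11 le11]]; split; split.
- by [].
- move=> s [prob_s inc_s] lt_s.
  apply: wp_mono (wp_candidate m0 prob_s inc_s lt_s).
  move=> s' _ [prob' inc' mono cand]; split=> //.
    rewrite /good => good_s; apply: leq_trans good_s _.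
    by rewrite leq_mul2l mono orbT.
  move=> eq_g; rewrite /good; have [->|/gP[g_vs g_heavy]] := posnP #|U|.
    by rewrite muln0.
  apply: cand cUvs _ _ => // [j jm|p pvs pk].
    by rewrite eq_g.
  by have [j jm gj] := g_heavy p pvs pk; exists j; rewrite ?eq_g.
- by split.
- case: g_lt => [U0|]; [left|by right=> j _].
  by rewrite /good U0 muln0.
Qed.

End Ptas.

(** * Passage to a real accuracy [eps] *)

Import Order.TTheory GRing.Theory Num.Theory.
Import numFieldNormedType.Exports.

Local Open Scope classical_set_scope.
Local Open Scope ring_scope.

Theorem theorem5 (R : realType) :
  exists expo : R -> R,
    expo =O_ (0^'+) (fun eps : R => eps^-1) /\
    forall eps : R, 0 < eps ->
      exists A : cmd,
        forall (n : nat) (E : rel 'I_n) (k : nat), (0 < k)%N ->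
          exists (s : state) (t : nat),
            [/\ exec A (input E k) s t,
                feasible E k (output n s),
                (1 - eps) * (opt E k)%:R <= #|output n s|%:R
              & (1 < n)%N -> t%:R <= n%:R `^ expo eps].
Proof.
have [C costC] := cost_exp_ptas.
(* For [eps > 0] this exceeds [1/eps], so the guaranteed ratio [(m - 1)/m] is above [1 - eps]. *)
pose m (eps : R) := (Num.truncn eps^-1).+1.
exists (fun eps => (C * (m eps).+1)%:R); split.
  (* [C.+1] keeps the constant positive even if [C] is zero; the 3 comes from
     [m + 1 <= 1/eps + 2 <= 3/eps] for [eps <= 1]. *)
  apply/eqO_exP; exists (C.+1%:R * 3); first by rewrite mulr_gt0 ?ltr0n.
  near=> eps.
  have eps0 : 0 < eps by near: eps; exact: nbhs_right_gt.
  have eps1 : eps <= 1 by near: eps; exact: nbhs_right_le.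
  have inv1 : 1 <= eps^-1 by rewrite invf_ge1.
  rewrite ger0_norm // gtr0_norm ?invr_gt0 //.
  have le_m : (m eps).+1%:R <= 3 * eps^-1.
    have : (Num.truncn eps^-1)%:R <= eps^-1 by rewrite truncn_le ?invr_ge0 ?ltW.
    by rewrite /m -addn2 natrD; lra.
  rewrite natrM; apply: le_trans (ler_wpM2l _ le_m) _; first exact: ler0n.
  by rewrite mulrA !ler_wpM2r ?invr_ge0 ?ler0n ?ler_nat // ltW.
move=> eps eps0; exists (ptas (m eps)) => n E k _.
have [s [t [ex feas le_opt le_t]]] := ptas_correct E k (ltn0Sn _ : (0 < m eps)%N).
exists s, t; split=> // [|n1].
  have m_eps : 1 <= (m eps)%:R * eps.
    by rewrite -ler_pdivrMr // mul1r ltW // truncnS_gt.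
  rewrite -(ler_pM2l (_ : 0 < (m eps)%:R)) ?ltr0n //.
  rewrite -(ler_nat R) !natrM in le_opt; apply: le_trans le_opt.
  rewrite mulrA ler_wpM2r ?ler0n // /= mulrBr mulr1.
  by rewrite lerBlDr {1}/m -addn1 natrD lerD2l.
(* The real exponent is a natural number, and the base [maxn n 2] is [n] because [n > 1]. *)
rewrite powR_mulrn ?ler0n // -natrX ler_nat; apply: leq_trans le_t _.
by rewrite (maxn_idPl n1) leq_exp2l.
Unshelve. all: by end_near.
Qed.
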